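(* Let $H\ge 1$. Suppose that $\mathcal T\cap\mathcal F=\emptyset$ and that $\mathcal T$ is controlled-invariant. If $x_t\in\mathcal{RA}(\mathcal T,\mathcal F,H)$, then there exists $u_t\in\mathcal U$ such that $x_{t+1}=f(x_t,u_t)\in\mathcal{RA}(\mathcal T,\mathcal F,H)$. Furthermore, the choice $u_t=u^{\mathrm b}$, where $u^{\mathrm b}\in\arg\max_{u\in\mathcal U}V(f(x_t,u),1)$, is feasible, i.e. $f(x_t,u^{\mathrm b})\in\mathcal{RA}(\mathcal T,\mathcal F,H)$.
   Context: Setting: $\mathcal X\subseteq\mathbb R^n$ is the state space, $\mathcal U\subseteq\mathbb R^m$ is a non-empty compact set, and the discrete-time dynamics are $x_{t+1}=f(x_t,u_t)$ with $f:\mathcal X\times\mathcal U\to\mathcal X$. For a policy $\pi:\mathcal X\to\mathcal U$, $\mathbf x(\tau;x_0,\pi)$, $\tau\ge 0$, denotes the state at time $\tau$ of the trajectory starting at $x_0$ under $\pi$. The failure set $\mathcal F\subseteq\mathcal X$ is open and $g:\mathcal X\to\mathbb R$ is Lipschitz continuous with $g(x)<0\iff x\in\mathcal F$. The target set $\mathcal T\subset\mathcal X$ is closed and $\ell:\mathcal X\to\mathbb R$ is Lipschitz continuous with $\ell(x)\ge 0\iff x\in\mathcal T$. A closed set $\Omega\subset\mathcal X$ is controlled-invariant (under a policy $\pi$) if $\mathbf x(\tau;x_0,\pi)\in\Omega$ for all $x_0\in\Omega$ and all $\tau\ge 0$; $\mathcal T$ is controlled-invariant under some policy $\pi^{\mathcal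 T}$. For integers $a\le b$, $[a,b]=\{a,a+1,\dots,b\}$. The reach-avoid set for horizon $H$ is $$\mathcal{RA}(\mathcal T,\mathcal F,H)=\{x\in\mathcal X:\ \exists\,\pi,\ \exists\, t\in[0,H],\ \mathbf x(t;x,\pi)\in\mathcal T\ \text{and}\ \mathbf x(\tau;x,\pi)\notin\mathcal F\ \ \forall\tau\in[0,t]\}.$$ The reach-avoid value function is, for $t\in[0,H]$, $$V(x_t,t)=\max_{\pi}\ \max_{\tau\in[t,H]}\min\Big\{\ell(x_\tau),\ \min_{s\in[t,\tau]}g(x_s)\Big\},\qquad x_\tau=\mathbf x(\tau-t;x_t,\pi).$$ It satisfies $V(x,t)=\min\{g(x),\max\{\ell(x),\max_{u\in\mathcal U}V(f(x,u),t+1)\}\}$ for $t<H$, with $V(x,H)=\min\{g(x),\ell(x)\}$, and $V(x,0)\ge 0\iff x\in\mathcal{RA}(\mathcal T,\mathcal F,H)$. All maxima written here are assumed to be attained. *)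

(* Defs.v *)
From mathcomp Require Export all_boot all_order all_algebra.
From mathcomp Require Export all_classical all_reals all_analysis.
Export Order.TTheory GRing.Theory Num.Theory numFieldNormedType.Exports.

Set Implicit Arguments.
Unset Strict Implicit.
Unset Printing Implicit Defensive.

Local Open Scope classical_set_scope.
Local Open Scope ring_scope.

Section ArgMax.
Context {R : realType} {T : Type}.

Definition argmax (A : set T) (h : T -> R) : set T :=
  [set a | A a /\ forall b, A b -> h b <= h a].

End ArgMax.

Section ReachAvoid.
Context {R : realType} {n m : nat}.
Variables (X : set 'rV[R]_n) (U : set 'rV[R]_m).
Variable f : 'rV[R]_n -> 'rV[R]_m -> 'rV[R]_n.

(* State feedbacks from X to U are total functions whose values outside X are
   irrelevant: the dynamics keep a trajectory started in X inside X. *)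
Definition policies : set ('rV[R]_n -> 'rV[R]_m) :=
  [set pi | forall x, X x -> U (pi x)].

Definition trajectory (pi : 'rV[R]_n -> 'rV[R]_m) (x0 : 'rV[R]_n) (tau : nat)
  : 'rV[R]_n := iter tau (fun x => f x (pi x)) x0.

Definition invariant_under (pi : 'rV[R]_n -> 'rV[R]_m) (Omega : set 'rV[R]_n)
  : Prop := forall x0 tau, Omega x0 -> Omega (trajectory pi x0 tau).

(* Open and closed sets are taken relatively to the state space X, through the
   subspace topology. *)
Definition controlled_invariant (Omega : set 'rV[R]_n) : Prop :=
  [/\ Omega `<=` X, closed (Omega : set (subspace X)) &
      exists2 pi, policies pi & invariant_under pi Omega].

Definition reach_avoid (T F : set 'rV[R]_n) (H : nat) : set 'rV[R]_n :=
  [set x | X x /\ exists2 pi, policies pi &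
     exists t, [/\ (t <= H)%N, T (trajectory pi x t) &
       forall tau, (tau <= t)%N -> ~ F (trajectory pi x tau)]].

Variables (l g : 'rV[R]_n -> R) (H : nat).

(* The state x is the state at time t, so that the state at time s >= t is
   trajectory pi x (s - t).  The default value g x of the iterated minimum is
   its term at s = t, and is thus neutral when t <= tau; likewise for the
   iterated maximum of best_outcome when t <= H. *)
Definition outcome (pi : 'rV[R]_n -> 'rV[R]_m) (x : 'rV[R]_n) (t tau : nat)
  : R :=
  Num.min (l (trajectory pi x (tau - t)))
    (\big[Num.min/g x]_(t <= s < tau.+1) g (trajectory pi x (s - t))).

Definition best_outcome (x : 'rV[R]_n) (t : nat) (pi : 'rV[R]_n -> 'rV[R]_m)
  : R :=
  \big[Num.max/outcome pi x t t]_(t <= tau < H.+1) outcome pi x t tau.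

(* A supremum, which is the maximum over all policies whenever
   argmax policies (best_outcome x t) is nonempty. *)
Definition value (x : 'rV[R]_n) (t : nat) : R :=
  sup [set best_outcome x t pi | pi in policies].

End ReachAvoid.

(* Main.v *)
(* A witness (pi, t) for x_t in RA(H) yields a control u with f(x_t, u) in
   RA(H - 1): for t > 0 follow pi, and for t = 0 the state is already in the
   target, where the invariant policy keeps it, away from the failure set.
   Since V(y, 1) >= 0 exactly when y is in RA(H - 1), a maximizer of
   V(f(x_t, .), 1) has a nonnegative value as well, and RA(H - 1) is included
   in RA(H). *)
Require Import Defs.

Set Implicit Arguments.
Unset Strict Implicit.
Unset Printing Implicit Defensive.

Local Open Scope classical_set_scope.
Local Open Scope ring_scope.

Lemma bigmin_seq_geP d (S : orderType d) (I : eqType) (r : seq I) (x c : S)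
    (h : I -> S) :
  (c <= \big[Order.min/x]_(i <- r) h i)%O <->
  (c <= x)%O /\ (forall i, i \in r -> (c <= h i)%O).
Proof.
elim: r => [|j r IHr]; first by rewrite big_nil; split => [|[]].
rewrite big_cons le_min; split=> [/andP[chj /IHr[cx chr]]|[cx chr]].
  by split=> // i; rewrite inE => /predU1P[->|/chr].
rewrite chr ?mem_head//=; apply/IHr; split=> // i ir.
by rewrite chr// inE ir orbT.
Qed.

Lemma bigmax_seq_geP d (S : orderType d) (I : eqType) (r : seq I) (x c : S)
    (h : I -> S) :
  (c <= \big[Order.max/x]_(i <- r) h i)%O <->
  (c <= x)%O \/ (exists2 i, i \in r & (c <= h i)%O).
Proof.
split=> [|[cx|[i ir chi]]]; last 2 first.
- exact: le_trans cx (bigmax_ge_id _ _ _ _).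
- exact: bigmax_sup_seq chi.
elim: r => [|j r IHr]; first by rewrite big_nil; left.
rewrite big_cons le_max => /orP[chj|/IHr[cx|[i ir chi]]].
- by right; exists j; rewrite ?mem_head.
- by left.
- by right; exists i; rewrite // inE ir orbT.
Qed.

(** Attainment provides both facts that a real supremum needs, a nonempty set and an upper bound;
    this replaces [value] by the outcome of one optimal policy. *)
Lemma sup_argmax (R : realType) (S : Type) (A : set S) (h : S -> R) (a : S) :
  argmax A h a -> sup [set h b | b in A] = h a.
Proof.
move=> [Aa h_le]; have ub : ubound [set h b | b in A] (h a).
  by move=> _ [b Ab <-]; exact: h_le.
apply/eqP; rewrite eq_le ge_sup//=; last by exists (h a), a.
by rewrite ub_le_sup//; [exists (h a) | exists a].
Qed.

Section ReachAvoidTheory.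
Context {R : realType} {n m : nat}.
Variables (X : set 'rV[R]_n) (U : set 'rV[R]_m).
Variable f : 'rV[R]_n -> 'rV[R]_m -> 'rV[R]_n.
Variables T F : set 'rV[R]_n.
Hypothesis f_closed : forall x u, X x -> U u -> X (f x u).

(** [iter] unfolds at the last step, while the tail of a trajectory is obtained by peeling off the
    first one; policies are stationary, so [pi] also drives the tail. *)
Lemma trajectoryS pi x k :
  trajectory f pi x k.+1 = trajectory f pi (f x (pi x)) k.
Proof. exact: iterSr. Qed.

Lemma trajectory_state pi x k : policies X U pi -> X x ->
  X (trajectory f pi x k).
Proof. by move=> Upi Xx; elim: k => //= k IHk; exact: f_closed (Upi _ _). Qed.

Lemma reach_avoid_leq h k : (h <= k)%N ->
  reach_avoid X U f T F h `<=` reach_avoid X U f T F k.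
Proof.
move=> hk x [Xx [pi Upi [t [th Tt Ft]]]].
by split=> //; exists pi => //; exists t; split=> //; exact: leq_trans hk.
Qed.

Lemma reach_avoid_step h x : T `&` F = set0 -> controlled_invariant X U f T ->
  reach_avoid X U f T F h x ->
  exists2 u, U u & reach_avoid X U f T F h.-1 (f x u).
Proof.
move=> TF0 [_ _ [piT UpiT invT]] [Xx [pi Upi [[|t] [th Tt Ft]]]].
  (* The reaching time after this step is again 0, so the case [h = 0], where [h.-1] is 0, is
     covered too. *)
  exists (piT x); first exact: UpiT.
  have Tfx : T (f x (piT x)) := invT x 1%N Tt.
  split; first exact: f_closed (UpiT _ Xx).
  exists piT => //; exists 0%N; split=> // tau; rewrite leqn0 => /eqP->/= Ffx.
  by have : (T `&` F) (f x (piT x)) by []; rewrite TF0.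
exists (pi x); first exact: Upi.
split; first exact: f_closed (Upi _ Xx).
exists pi => //; exists t; split=> [||tau tau_t].
- by case: h th.
- by rewrite -trajectoryS.
- by rewrite -trajectoryS; exact: Ft.
Qed.

Variables l g : 'rV[R]_n -> R.
Hypothesis g_sign : forall x, X x -> (g x < 0 <-> F x).
Hypothesis l_sign : forall x, X x -> (0 <= l x <-> T x).

(** A minimum is nonnegative iff all its terms are, and the signs of [l] and [g] encode [T] and the
    complement of [F]. Times are counted from [t]. *)
Lemma outcome_ge0 pi x t tau : policies X U pi -> X x -> (t <= tau)%N ->
  0 <= outcome f l g pi x t tau <->
  T (trajectory f pi x (tau - t)) /\
  (forall s, (s <= tau - t)%N -> ~ F (trajectory f pi x s)).
Proof.
move=> Upi Xx t_tau.
have Xtr s : X (trajectory f pi x s) by exact: trajectory_state.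
have safe y : X y -> (0 <= g y <-> ~ F y).
  by move=> Xy; rewrite -(g_sign Xy) leNgt; split=> /negP.
rewrite /outcome le_min; split=> [/andP[/(l_sign (Xtr _)) Ttau]|[Ttau Fs]].
  move=> /bigmin_seq_geP[_ g_ge0]; split=> // s s_tau; apply/safe => //.
  (* Relative time [s] is the index [t + s] of the iterated minimum. *)
  rewrite -[s](addKn t); apply: g_ge0.
  by rewrite mem_index_iota leq_addr ltnS -(subnKC t_tau) leq_add2l.
apply/andP; split; first exact/l_sign.
apply/bigmin_seq_geP; split=> [|s]; first exact/safe/(Fs 0%N).
rewrite mem_index_iota ltnS => /andP[ts s_tau].
by apply/safe => //; apply: Fs; exact: leq_sub2r.
Qed.

Lemma best_outcome_ge0 H x t pi : policies X U pi -> X x -> (t <= H)%N ->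
  0 <= best_outcome f l g H x t pi <->
  exists k, [/\ (k <= H - t)%N, T (trajectory f pi x k) &
    forall s, (s <= k)%N -> ~ F (trajectory f pi x s)].
Proof.
move=> Upi Xx tH; split=> [/bigmax_seq_geP[|[tau]]|[k [kH Tk Fs]]].
(* The default of the iterated maximum is the outcome of stopping at once, whence the witness 0. *)
- move=> /(outcome_ge0 Upi Xx (leqnn t)); rewrite subnn => -[Tx Fx].
  by exists 0%N.
- rewrite mem_index_iota ltnS => /andP[t_tau tauH].
  move=> /(outcome_ge0 Upi Xx t_tau)[Ttau Fs].
  by exists (tau - t)%N; split=> //; exact: leq_sub2r.
- apply/bigmax_seq_geP; right; exists (t + k)%N.
    by rewrite mem_index_iota leq_addr ltnS -(subnKC tH) leq_add2l.
  by apply/(outcome_ge0 Upi Xx (leq_addr k t)); rewrite addKn.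
Qed.

(** Attainment matters from left to right: a supremum equal to 0 could be approached by negative
    outcomes only, whereas a maximizer is itself a reach-avoid policy. Conversely, a maximizer does
    at least as well as any witness. *)
Lemma value_ge0 H x t : X x -> (t <= H)%N ->
  argmax (policies X U) (best_outcome f l g H x t) !=set0 ->
  0 <= value X U f l g H x t <-> reach_avoid X U f T F (H - t) x.
Proof.
move=> Xx tH [pi pi_max]; rewrite /value (sup_argmax pi_max).
case: pi_max => Upi pi_max; split=> [/(best_outcome_ge0 Upi Xx tH) ?|].
  by split=> //; exists pi.
move=> [_ [pi' Upi' reach]]; apply: le_trans (pi_max _ Upi').
exact/best_outcome_ge0.
Qed.

End ReachAvoidTheory.

Theorem theorem1 (R : realType) (n m : nat)
    (X : set 'rV[R]_n) (U : set 'rV[R]_m)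
    (f : 'rV[R]_n -> 'rV[R]_m -> 'rV[R]_n)
    (T F : set 'rV[R]_n) (l g : 'rV[R]_n -> R) (H : nat)
    (U_nonempty : U !=set0)
    (U_compact : compact U)
    (f_closed : forall x u, X x -> U u -> X (f x u))
    (F_sub : F `<=` X)
    (F_open : open (F : set (subspace X)))
    (g_lipschitz : [lipschitz g x | x in X])
    (g_sign : forall x, X x -> (g x < 0 <-> F x))
    (T_sub : T `<=` X)
    (T_closed : closed (T : set (subspace X)))
    (l_lipschitz : [lipschitz l x | x in X])
    (l_sign : forall x, X x -> (0 <= l x <-> T x))
    (value_attained : forall x t, X x -> (t <= H)%N ->
       argmax (policies X U) (best_outcome f l g H x t) !=set0)
    (bellman_attained : forall x t, X x -> (t < H)%N ->
       argmax U (fun u => value X U f l g H (f x u) t.+1) !=set0)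
    (H_ge1 : (1 <= H)%N)
    (T_F_disjoint : T `&` F = set0)
    (T_invariant : controlled_invariant X U f T)
    (xt : 'rV[R]_n)
    (xt_reach_avoid : reach_avoid X U f T F H xt) :
  (exists2 ut, U ut & reach_avoid X U f T F H (f xt ut)) /\
  (forall ub, argmax U (fun u => value X U f l g H (f xt u) 1%N) ub ->
     reach_avoid X U f T F H (f xt ub)).
Proof.
have RA_pred := @reach_avoid_leq _ _ _ X U f T F _ _ (leq_pred H).
have [u Uu RAu] := reach_avoid_step f_closed T_F_disjoint T_invariant
  xt_reach_avoid.
split=> [|ub [Uub ub_max]]; first by exists u => //; exact: RA_pred.
have [Xxt _] := xt_reach_avoid.
(* At time 1 the remaining horizon is [H - 1], exactly the one that [reach_avoid_step] leaves;
   [H_ge1] makes time 1 admissible. *)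
have value1 v : U v -> 0 <= value X U f l g H (f xt v) 1 <->
    reach_avoid X U f T F H.-1 (f xt v).
  move=> Uv; have Xv := f_closed _ _ Xxt Uv; rewrite -subn1.
  exact: (value_ge0 f_closed g_sign l_sign Xv H_ge1 (value_attained _ _ Xv H_ge1)).
by apply/RA_pred/value1 => //; apply: le_trans (ub_max _ Uu); exact/value1.
Qed.
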